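(* Let $X$ be a normal ($T_4$) topological space. The correspondence $I\mapsto E_B(I)$ is a one-one map from the set of all (proper) $e_B$-ideals in $B_1^*(X)$ onto the set of all $e_B$-filters on $X$.
   Context: A Baire one function on $X$ is a function $f:X\to\mathbb{R}$ that is the pointwise limit of a sequence of continuous real-valued functions on $X$. $B_1(X)$ is the ring, under pointwise operations, of all Baire one functions on $X$, and $B_1^*(X)$ is its subring of bounded functions. For $f\in B_1(X)$, $Z(f)=\{x\in X: f(x)=0\}$, and $Z(B_1(X))=\{Z(f): f\in B_1(X)\}$. A $Z_B$-filter on $X$ is a nonempty $\mathscr F\subseteq Z(B_1(X))$ such that (1) $\emptyset\notin\mathscr F$; (2) $Z_1,Z_2\in\mathscr F$ implies $Z_1\cap Z_2\in\mathscr F$; (3) $Z\in\mathscr F$, $Z'\in Z(B_1(X))$ and $Z\subseteq Z'$ imply $Z'\in\mathscr F$. For $f\in B_1^*(X)$ and $\epsilon>0$, $E_B^\epsilon(f)=\{x\in X: |f(x)|\le\epsilon\}$ (a member of $Z(B_1(X))$). For nonempty $I\subseteq B_1^*(X)$, $E_B(I)=\{E_B^\epsilon(f): f\in I,\ \epsilon>0\}$. For $\mathscr F\subseteq Z(B_1(X))$, $E_B^{-1}(\mathscr F)=\{f\in B_1^*(X): E_B^\epsilon(f)\in\mathscr F\text{ for all }\epsilon>0\}$. A proper ideal $I$ of $B_1^*(X)$ is an $e_B$-ideal if $I=E_B^{-1}(E_B(I))$. A $Z_B$-filter $\mathscr F$ is an $e_B$-filter if $\mathscr F=E_B(E_B^{-1}(\mathscr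 F))$. *)

(* Defs.v *)
From mathcomp Require Import all_boot all_order all_algebra.
From mathcomp Require Import all_classical all_reals all_analysis.
Import Order.TTheory GRing.Theory Num.Theory.
Import numFieldNormedType.Exports.

Set Implicit Arguments.
Unset Strict Implicit.
Unset Printing Implicit Defensive.

Local Open Scope classical_set_scope.
Local Open Scope ring_scope.

(* [normal_space] alone does not include any point-separation axiom. *)
Definition T4_space (X : topologicalType) : Prop :=
  normal_space X /\ accessible_space X.

(* The ring operations on [X -> R] are the pointwise ones. [X] may be empty, so
   [X -> R] is only a [comPzRingType]; the ideals of [ring_quotient] require
   [1 != 0], which is why ideals are defined here. [A] is meant to be (the
   carrier of) a subring of [S]. *)
Definition ideal_of (S : comPzRingType) (A I : set S) : Prop :=
  [/\ I `<=` A,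
      I !=set0,
      forall f g, I f -> I g -> I (f - g)
    & forall a f, A a -> I f -> I (a * f)].

Definition proper_ideal_of (S : comPzRingType) (A I : set S) : Prop :=
  ideal_of A I /\ I <> A.

Section Baire_one.
Variables (R : realType) (X : topologicalType).
Implicit Types (f : X -> R) (I : set (X -> R)) (F : set (set X)).

Definition B1 : set (X -> R) :=
  [set f | exists u : nat -> X -> R,
     (forall n, continuous (u n)) /\ (forall x, u ^~ x @ \oo --> f x)].

Definition B1_bounded : set (X -> R) := B1 `&` bounded_fun.

Definition zero_set f : set X := [set x | f x = 0].

Definition ZB1 : set (set X) := [set zero_set f | f in B1].

Definition ZB_filter F : Prop :=
  [/\ F `<=` ZB1 /\ F !=set0,
      ~ F set0,
      forall Z1 Z2, F Z1 -> F Z2 -> F (Z1 `&` Z2)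
    & forall Z Z', F Z -> ZB1 Z' -> Z `<=` Z' -> F Z'].

Definition EB_eps (e : R) f : set X := [set x | `|f x| <= e].

Definition EB I : set (set X) :=
  [set Z | exists f e, [/\ I f, 0 < e & Z = EB_eps e f]].

Definition EB_inv F : set (X -> R) :=
  [set f | B1_bounded f /\ forall e, 0 < e -> F (EB_eps e f)].

Definition eB_ideal I : Prop :=
  proper_ideal_of B1_bounded I /\ I = EB_inv (EB I).

Definition eB_filter F : Prop := ZB_filter F /\ F = EB (EB_inv F).

End Baire_one.

(* Main.v *)
Require Import Defs.
From mathcomp Require Import all_boot all_order all_algebra.
From mathcomp Require Import all_classical all_reals all_analysis.
From mathcomp Require Import ring lra.
Import Order.TTheory GRing.Theory Num.Theory.
Import numFieldNormedType.Exports.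

Local Open Scope classical_set_scope.

(** On [e_B]-ideals and [e_B]-filters, [EB] and [EB_inv] are mutually inverse by
    definition, so it is enough that [EB] sends proper ideals to filters and
    [EB_inv] filters to proper ideals. Only the superset axiom for [EB I] is
    delicate: if [f] is in [I] and [{|f| <= e}] is contained in the zero set of a
    bounded [k >= 0], then [h := f^2 (e^2 / max(f^2, e^2) + k)], which equals
    [min(f^2, e^2) + f^2 k], is in [I], and [{|h| <= e^2}] is exactly the zero
    set of [k]. *)

Section Baire_one_ring.
Local Open Scope ring_scope.
Context {R : realType} {X : topologicalType}.
Implicit Types (f g : X -> R) (I : set (X -> R)) (F : set (set X)).

(** * Closure properties of Baire one functions and their zero sets *)

Lemma B1_cst (c : R) : B1 (fun _ : X => c).
Proof.
exists (fun _ _ => c); split=> [n x|x]; exact: cvg_cst.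
Qed.

Lemma B1D f g : B1 f -> B1 g -> B1 (fun x => f x + g x).
Proof.
move=> [u [cu uf]] [v [cv vg]]; exists (fun n x => u n x + v n x).
by split=> [n x|x]; [apply: cvgD; [exact: cu|exact: cv] | apply: cvgD].
Qed.

Lemma B1M f g : B1 f -> B1 g -> B1 (fun x => f x * g x).
Proof.
move=> [u [cu uf]] [v [cv vg]]; exists (fun n x => u n x * v n x).
by split=> [n x|x]; [apply: cvgM; [exact: cu|exact: cv] | apply: cvgM].
Qed.

Lemma B1_comp (phi : R -> R) f : continuous phi -> B1 f -> B1 (phi \o f).
Proof.
move=> cphi [u [cu uf]]; exists (fun n => phi \o u n); split=> [n x|x].
  by apply: continuous_comp; [exact: cu | exact: cphi].
by apply: continuous_cvg; [exact: cphi | exact: uf].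
Qed.

Lemma B1B f g : B1 f -> B1 g -> B1 (fun x => f x - g x).
Proof.
by move=> Bf Bg; apply: B1D => //; apply: B1_comp Bg => y; exact: opp_continuous.
Qed.

(** Replaces the bounds near infinity in [bounded_fun] by a single [M], positive so that it can be
    divided by. *)
Lemma B1_boundedP f :
  B1_bounded f <-> B1 f /\ exists2 M : R, 0 < M & forall x, `|f x| <= M.
Proof.
split=> -[Bf bf]; split=> //.
  by have [M M0 Mf] := (ex_strict_bound_gt0 bf); exists M => // x; apply/ltW/Mf.
case: bf => M _ Mf; exists M; split; first exact: num_real.
by move=> N MN x _; exact: le_trans (Mf x) (ltW MN).
Qed.

Lemma B1_boundedM f g :
  B1_bounded f -> B1_bounded g -> B1_bounded (fun x => f x * g x).
Proof.
move=> /B1_boundedP[Bf [M M0 fM]] /B1_boundedP[Bg [N N0 gN]].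
apply/B1_boundedP; split; first exact: B1M.
by exists (M * N) => [|x]; [exact: mulr_gt0 | rewrite normrM ler_pM].
Qed.

Lemma B1_boundedD f g :
  B1_bounded f -> B1_bounded g -> B1_bounded (fun x => f x + g x).
Proof.
move=> /B1_boundedP[Bf [M M0 fM]] /B1_boundedP[Bg [N N0 gN]].
apply/B1_boundedP; split; first exact: B1D.
exists (M + N) => [|x]; first exact: addr_gt0.
by rewrite (le_trans (ler_normD _ _)) // lerD.
Qed.

Lemma B1_bounded_cst (c : R) : B1_bounded (fun _ : X => c).
Proof.
apply/B1_boundedP; split; first exact: B1_cst.
by exists (`|c| + 1) => [|_]; [exact: ltr_wpDl | rewrite lerDl].
Qed.

(** The continuous function [max(|y| - e, 0)] vanishes exactly when [|y| <= e]. *)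
Lemma ZB1_EB_eps (e : R) f : B1 f -> ZB1 R (EB_eps e f).
Proof.
move=> Bf; exists ((fun y : R => Num.max (`|y| - e) 0) \o f).
  apply: B1_comp => // y.
  apply: (continuous_max (f := fun y : R => `|y| - e) (g := cst 0)).
    by apply: cvgB; [exact: norm_continuous | exact: cst_continuous].
  exact: cst_continuous.
apply/seteqP; split=> x; rewrite /zero_set /EB_eps /= => h.
  by rewrite -subr_le0 -h le_max lexx.
by apply/max_idPr; rewrite subr_le0.
Qed.

Lemma ZB1_setI (Z1 Z2 : set X) : ZB1 R Z1 -> ZB1 R Z2 -> ZB1 R (Z1 `&` Z2).
Proof.
move=> [f Bf <-] [g Bg <-]; exists (fun x => f x * f x + g x * g x).
  by apply: B1D; exact: B1M.
apply/seteqP; split=> x; rewrite /zero_set /=; last first.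
  by move=> [-> ->]; rewrite !mul0r addr0.
move/eqP; rewrite paddr_eq0 -?expr2 ?sqr_ge0// !sqrf_eq0.
by case/andP=> /eqP -> /eqP ->.
Qed.

(** Truncating [|f|] at height 1 keeps its zero set; boundedness lets [k] occur in a multiplier of
    an ideal element. *)
Lemma ZB1_bounded_ge0 (Z : set X) : ZB1 R Z ->
  exists k : X -> R, [/\ B1_bounded k, forall x, 0 <= k x & zero_set k = Z].
Proof.
move=> [f Bf <-]; exists ((fun y : R => Num.min `|y| 1) \o f); split.
- apply/B1_boundedP; split.
    apply: B1_comp => // y.
    apply: (continuous_min (f := fun y : R => `|y|) (g := cst 1)).
      exact: norm_continuous.
    exact: cst_continuous.
  exists 1 => // x /=; rewrite ger0_norm; first by rewrite ge_min lexx orbT.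
  by rewrite le_min normr_ge0 ler01.
- by move=> x /=; rewrite le_min normr_ge0 ler01.
apply/seteqP; split=> x; rewrite /zero_set /= => h; last first.
  by rewrite h normr0; apply/min_idPl.
apply/eqP; rewrite -normr_eq0; apply/eqP; move: h.
by rewrite minEle; case: ifP => // _ /eqP; rewrite oner_eq0.
Qed.

(* [truncinv e y * y = min(y, e)] for [y >= 0]. *)
Definition truncinv (e y : R) : R := e / Num.max y e.

(** The denominator [max(y, e)] is at least [e > 0], so the quotient is continuous in [y] with
    values in [(0, 1]]. *)
Lemma B1_bounded_truncinv (e : R) f : 0 < e -> B1 f ->
  B1_bounded (truncinv e \o f).
Proof.
move=> e0 Bf; have m0 y : 0 < Num.max y e by rewrite lt_max e0 orbT.
apply/B1_boundedP; split.
  apply: B1_comp => // y; apply: cvgM; first exact: cst_continuous.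
  apply: cvgV; first exact: lt0r_neq0.
  apply: (continuous_max (f := fun y : R => y) (g := cst e)).
    exact: cvg_id.
  exact: cst_continuous.
exists 1 => // x /=; rewrite ger0_norm; last by rewrite divr_ge0 // ltW.
by rewrite ler_pdivrMr // mul1r le_max lexx orbT.
Qed.

Lemma truncinv_le (e y : R) : 0 < e -> y <= e -> truncinv e y = 1.
Proof. by move=> e0 ye; rewrite /truncinv (max_idPr ye) divff ?lt0r_neq0. Qed.

Lemma truncinv_gt (e y : R) : 0 < e -> e < y -> y * truncinv e y = e.
Proof.
move=> e0 ey; rewrite /truncinv (max_idPl (ltW ey)) mulrC divfK//.
by rewrite lt0r_neq0 // (lt_trans e0).
Qed.

(** * From ideals to filters *)

Section ideal.
Variable I : set (X -> R).
Hypothesis idI : ideal_of (@B1_bounded R X) I.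

Lemma idealM a f : B1_bounded a -> I f -> I (fun x => a x * f x).
Proof. by case: idI => _ _ _; apply. Qed.

Lemma idealD f g : I f -> I g -> I (fun x => f x + g x).
Proof.
case: idI => _ _ IB _ If Ig.
have IN : I (fun x => -1 * g x) by exact: idealM (B1_bounded_cst _) Ig.
have := IB _ _ If IN; congr I; apply/funext => x.
by rewrite !fctE mulN1r opprK.
Qed.

Lemma ideal_B1_bounded f : I f -> B1_bounded f.
Proof. by case: idI => IA _ _ _; exact: IA. Qed.

Lemma EB_superset (e : R) f (Z : set X) : I f -> 0 < e -> ZB1 R Z ->
  EB_eps e f `<=` Z -> EB I Z.
Proof.
move=> If e0 /ZB1_bounded_ge0[k [Bk k0 <-]] sub.
have Bf := ideal_B1_bounded _ If.
have e20 : 0 < e ^+ 2 by exact: exprn_gt0.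
pose t x := truncinv (e ^+ 2) (f x * f x).
(* One factor [f] is kept apart as the element of [I]; all the rest is a bounded multiplier. *)
pose h x := f x * (t x + k x) * f x.
exists h, (e ^+ 2); split => //.
  apply: idealM => //; apply: B1_boundedM => //; apply: B1_boundedD => //.
  by apply: B1_bounded_truncinv => //; case: Bf => Bf _; exact: B1M.
have ltE x : (e ^+ 2 < f x * f x) = (e < `|f x|).
  by rewrite -expr2 -(real_normK (num_real (f x))) ltr_pXn2r ?nnegrE ?(ltW e0).
have hE x : h x = f x * f x * t x + f x * f x * k x.
  by rewrite /h; ring.
apply/seteqP; split=> x; rewrite /zero_set /EB_eps /=.
  (* Where [k] vanishes, [h] is [min(f^2, e^2)], hence at most [e^2]. *)
  move=> kx; rewrite hE kx mulr0 addr0 /t.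
  have [le|gt] := leP (f x * f x) (e ^+ 2).
    by rewrite truncinv_le // mulr1 ger0_norm // -expr2 sqr_ge0.
  by rewrite truncinv_gt // ger0_norm // ltW.
(* If [|f x| <= e], the inclusion gives [k x = 0]. Otherwise [h = e^2 + f^2 k], and [h <= e^2]
   forces [k x <= 0]. *)
have [le _|gt] := leP `|f x| e; first exact: sub.
have gt2 : e ^+ 2 < f x * f x by rewrite ltE.
have f2 : 0 < f x * f x by exact: lt_trans gt2.
rewrite hE /t truncinv_gt // => /ler_normlW.
rewrite gerDl pmulr_rle0 // => k_le0.
by apply/eqP; rewrite eq_le k_le0 k0.
Qed.

Lemma ZB_filter_EB : I <> @B1_bounded R X -> ZB_filter R (EB I).
Proof.
move=> properI; split.
- split=> [Z [f [e [If e0 ->]]]|].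
    by apply: ZB1_EB_eps; case: (ideal_B1_bounded _ If).
  case: idI => _ [f If] _ _; exists (EB_eps 1 f), f, 1; split=> //.
(* If [EB_eps e f] is empty then [|f| > e] everywhere, so [f] has a bounded Baire one inverse and
   every [g] is a multiple of [f]. *)
- move=> [f [e [If e0 E0]]]; apply: properI; apply/seteqP.
  split=> [g|g Bg]; first exact: ideal_B1_bounded.
  have Bf := ideal_B1_bounded _ If.
  have e20 : 0 < e ^+ 2 by exact: exprn_gt0.
  pose t x := truncinv (e ^+ 2) (f x * f x).
  (* Off the empty set [EB_eps e f], the inverse of [f] is [e^-2 f t]. *)
  pose a x := g x * ((e ^+ 2)^-1 * (f x * t x)).
  have Ba : B1_bounded a.
    apply: B1_boundedM => //; apply: B1_boundedM; first exact: B1_bounded_cst.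
    apply: B1_boundedM => //; apply: B1_bounded_truncinv => //.
    by case: Bf => Bf _; exact: B1M.
  have := idealM _ _ Ba If; congr I; apply/funext => x.
  have gt2 : e ^+ 2 < f x * f x.
    rewrite -expr2 -(real_normK (num_real (f x))) ltr_pXn2r ?nnegrE ?(ltW e0)//.
    by rewrite ltNge; apply/negP => le; have : set0 x by rewrite E0.
  have tE : f x * f x * t x = e ^+ 2 by exact: truncinv_gt.
  have -> : a x * f x = g x * ((e ^+ 2)^-1 * (f x * f x * t x)).
    by rewrite /a; ring.
  by rewrite tE mulVf ?mulr1 // lt0r_neq0.
- move=> _ _ [f [e [If e0 ->]]] [g [d [Ig d0 ->]]].
  have Bf := ideal_B1_bounded _ If; have Bg := ideal_B1_bounded _ Ig.
  (* Both terms are nonnegative, so [k <= e^2 d^2] bounds each of them and yields [|f| <= e] and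
     [|g| <= d]. *)
  pose k x := (d ^+ 2 * f x) * f x + (e ^+ 2 * g x) * g x.
  have Ik : I k.
    by apply: idealD; apply: idealM => //;
       apply: B1_boundedM => //; exact: B1_bounded_cst.
  apply: (EB_superset (e ^+ 2 * d ^+ 2) k) => //.
  + by rewrite mulr_gt0 ?exprn_gt0.
  + by case: Bf Bg => Bf _ [Bg _]; apply: ZB1_setI; exact: ZB1_EB_eps.
  move=> x; rewrite /EB_eps /= => /ler_normlW; rewrite /k => kx.
  have sqle (y c : R) : 0 < c -> y ^+ 2 <= c ^+ 2 -> `|y| <= c.
    move=> c0; rewrite -(real_normK (num_real y)) ler_pXn2r ?nnegrE//.
    exact: ltW.
  have f2 : 0 <= d ^+ 2 * f x ^+ 2 by rewrite mulr_ge0 ?sqr_ge0.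
  have g2 : 0 <= e ^+ 2 * g x ^+ 2 by rewrite mulr_ge0 ?sqr_ge0.
  split; apply: sqle => //.
    by rewrite -(@ler_pM2l _ (d ^+ 2)) ?exprn_gt0//; lra.
  by rewrite -(@ler_pM2l _ (e ^+ 2)) ?exprn_gt0//; lra.
- move=> Z Z' [f [e [If e0 ->]]] ZZ' sub; exact: EB_superset sub.
Qed.

End ideal.

(** * From filters to ideals *)

Lemma proper_ideal_EB_inv F : ZB_filter R F ->
  proper_ideal_of (@B1_bounded R X) (EB_inv F).
Proof.
move=> [[FZ [Z0 FZ0]] F0 FI FS]; split; first split.
- by move=> f [].
- exists (fun=> 0); split; first exact: B1_bounded_cst.
  move=> e e0; apply: FS FZ0 _ _; first exact/ZB1_EB_eps/B1_cst.
  by move=> x _; rewrite /EB_eps /= normr0 ltW.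
- move=> f g [Bf Ff] [Bg Fg]; split.
    have Bng := B1_boundedM _ _ (B1_bounded_cst (-1)) Bg.
    have := B1_boundedD _ _ Bf Bng; congr B1_bounded.
    by apply/funext => x; rewrite !fctE mulN1r.
  move=> e e0; have e20 : 0 < e / 2 by rewrite divr_gt0.
  apply: FS (FI _ _ (Ff _ e20) (Fg _ e20)) _ _.
    by apply: ZB1_EB_eps; case: Bf Bg => Bf _ [Bg _]; exact: B1B.
  move=> x [/= fx gx]; rewrite /EB_eps /= !fctE.
  by rewrite (le_trans (ler_normB _ _))// [leRHS]splitr lerD.
- move=> a f Ba [Bf Ff]; split; first exact: B1_boundedM.
  move=> e e0; have /B1_boundedP[_ [M M0 aM]] := Ba.
  (* With [|a| <= M], the bound [|f| <= e / M] gives [|a f| <= e]. *)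
  apply: FS (Ff (e / M) (divr_gt0 e0 M0)) _ _.
    by apply: ZB1_EB_eps; case: (B1_boundedM _ _ Ba Bf).
  move=> x; rewrite /EB_eps /= !fctE ler_pdivlMr // mulrC normrM.
  by apply: le_trans; rewrite ler_wpM2r.
(* Properness: the constant 1 would put the empty set [{|1| <= 1/2}] into [F]. *)
- move=> IE; have [_ /(_ 2^-1)] : EB_inv F (fun=> 1 : R).
    by rewrite IE; exact: B1_bounded_cst.
  rewrite invr_gt0 ltr0n => /(_ isT) F1; apply: F0; move: F1; congr F.
  apply/seteqP; split=> x //; rewrite /EB_eps /= normr1.
  by rewrite leNgt invf_lt1 ?ltr0n// ltr1n.
Qed.

End Baire_one_ring.

Theorem corollary3p7 (R : realType) (X : topologicalType) (hX : T4_space X) :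
  set_bij [set I : set (X -> R) | eB_ideal I]
          [set F : set (set X) | eB_filter R F]
          (fun I : set (X -> R) => EB I).
Proof.
split.
- move=> I [[idI properI] IE]; split; first exact: ZB_filter_EB.
  by rewrite -IE.
- by move=> I J; rewrite !inE => -[_ IE] [_ JE] EIJ; rewrite IE JE EIJ.
(* Applying [EB_inv] to both sides of [FE] gives the fixed-point equation for [EB_inv F]. *)
- move=> F [ZF FE]; exists (EB_inv F) => //; split.
    exact: proper_ideal_EB_inv.
  by rewrite -FE.
Qed.
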